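(* Let $n\ge 1$. Let $\mathcal{H}_n$ be the set of all halved alternating sign matrices $A=(a_{ij})_{1\le i\le n,\,1\le j\le 2n}$ of order $2n$ whose height matrix $h=(h_{ij})_{0\le i\le n,\,0\le j\le 2n}$ satisfies the boundary condition $h_{n,2i}=n$ for all $0\le i\le n$, and write $c_i(A)=h_{n,2i-1}$ for $1\le i\le n$. Let $\mathcal{H}_n^{+}$ be the set of $A\in\mathcal{H}_n$ with $c_i(A)=n+1$ for all $1\le i\le n$, and let $\mathcal{H}_n^{-}$ be the set of $A\in\mathcal{H}_n$ with $c_i(A)=n-1$ for all $1\le i\le n$. For $A\in\mathcal{H}_n$ let $N_{-}(A,\mathrm{even})$ be the number of pairs $(i,j)$ with $i+j$ even and $a_{ij}=-1$, let $N_{+}(A,\mathrm{odd})$ be the number of pairs $(i,j)$ with $i+j$ odd and $a_{ij}=1$, and set $w(A)=2^{N_{-}(A,\mathrm{even})+N_{+}(A,\mathrm{odd})}$. Then $$\sum_{A\in\mathcal{H}_n^{+}}w(A)=\begin{cases}5^{\binom n2}&\text{if } n \text{ is even},\\ 2^n\,5^{\binom n2}&\text{if } n\text{ is odd},\end{cases}\qquad \sum_{A\in\mathcal{H}_n^{-}}w(A)=\begin{cases}2^n\,5^{\binom n2}&\text{if } n \text{ is even},\\ 5^{\binom n2}&\text{if } n\text{ is odd}.\end{cases}$$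
   Context: A halved alternating sign matrix of order $2n$ is an $n\times 2n$ matrix $A=(a_{ij})_{1\le i\le n,\,1\le j\le 2n}$ with entries in $\{0,1,-1\}$ such that: in each row and in each column the non-zero entries alternate in sign; each row sum equals $1$; and in each column the first (topmost) non-zero entry, if there is any, equals $1$. The height matrix of $A$ is the $(n+1)\times(2n+1)$ matrix $h$ with $h_{ij}=i+j-2\sum_{l=1}^{i}\sum_{r=1}^{j}a_{lr}$ for $0\le i\le n$, $0\le j\le 2n$ (empty sums are $0$). Its top row is automatically $(0,1,\dots,2n)$, its left column is $(0,1,\dots,n)$, its right column is $(2n,2n-1,\dots,n)$ (top to bottom), and adjacent entries differ by one. The boundary condition in the claim says that the bottom row of $h$ has the form $(n,c_1,n,c_2,n,\dots,n,c_n,n)$. *)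

(* Defs.v *)
From mathcomp Require Import all_boot all_order all_algebra.

Set Implicit Arguments.
Unset Strict Implicit.
Unset Printing Implicit Defensive.

Import GRing.Theory.

(* The subtype {0, 1, -1} of int; being finite, it makes the matrices over it
   a finType, so that they can be summed over. *)
Definition entry : Type := seq_sub ([:: 0; 1; -1]%R : seq int).

Definition nonzeros (s : seq int) : seq int := [seq x <- s | x != 0%R].

Definition alternating (s : seq int) : bool :=
  sorted (fun x y => y == - x)%R (nonzeros s).

Section HalvedASM.

Variable n : nat.

(* Rows and columns are indexed from 0: the entry a_{ij} of the literature,
   with i, j >= 1, is A (i - 1) (j - 1). *)
Implicit Type A : 'M[entry]_(n, n.*2).

Definition row_seq A (i : 'I_n) : seq int :=
  [seq val (A i j) | j <- enum 'I_(n.*2)].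

Definition col_seq A (j : 'I_(n.*2)) : seq int :=
  [seq val (A i j) | i <- enum 'I_n].

(* The default value 1 of head covers the columns without non-zero entry. *)
Definition halved_asm A : bool :=
  [&& [forall i, alternating (row_seq A i)],
      [forall j, alternating (col_seq A j)],
      [forall i, (\sum_j val (A i j))%R == 1%R]
    & [forall j, head 1%R (nonzeros (col_seq A j)) == 1%R]].

(* h_{ij} for 0 <= i <= n and 0 <= j <= 2n. *)
Definition height A (i j : nat) : int :=
  ((i + j)%N%:Z -
   2 * \sum_(l < n | (l < i)%N) \sum_(r < n.*2 | (r < j)%N) val (A l r))%R.

Definition halved_bdry : {set 'M[entry]_(n, n.*2)} :=
  [set A | halved_asm A
         & [forall i : 'I_n.+1, height A n i.*2 == n%:Z]%R].

(* bottom A i is c_{i+1}(A). *)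
Definition bottom A (i : 'I_n) : int := height A n i.*2.+1.

Definition halved_plus : {set 'M[entry]_(n, n.*2)} :=
  [set A in halved_bdry | [forall i, bottom A i == n%:Z + 1]%R].

Definition halved_minus : {set 'M[entry]_(n, n.*2)} :=
  [set A in halved_bdry | [forall i, bottom A i == n%:Z - 1]%R].

(* The parity of i + j is the same for indices starting at 0 and at 1. *)
Definition num_minus_even A : nat :=
  #|[set p : 'I_n * 'I_(n.*2) |
      ~~ odd (p.1 + p.2) & val (A p.1 p.2) == (-1)%R]|.

Definition num_plus_odd A : nat :=
  #|[set p : 'I_n * 'I_(n.*2) |
      odd (p.1 + p.2) & val (A p.1 p.2) == 1%R]|.

Definition weight A : nat := 2 ^ (num_minus_even A + num_plus_odd A).

End HalvedASM.

(* Main.v *)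
(* Row by row, a halved ASM is a path of subsets of the columns, the set after
   i rows consisting of the columns whose first i entries sum to 1, and the
   boundary condition with constant c_i says that the last set is that of the
   even, or of the odd, columns.
   A +1 and a -1 at the same position have weights with product 2, so that a
   row which moves the points l_1 < ... < l_r to k_1 < ... < k_{r+1}, where
   k_1 <= l_1 <= k_2 <= ..., has weight prod_b P(k_b) prod_b M(l_b), with an
   extra factor 1/2 for each l_b that is also some k_c: the l_b are summed by
   the trapezoid rule between consecutive k_b. By induction the weighted sum
   over the paths ending at k_1 < ... < k_n is a product of entry weights
   times det (g_a(k_b)), where g_0 = 1 and g_{a+1} is the trapezoid sum of g_a
   against the squared weight, which is alternately 4 and 1. On columns of
   fixed parity the a-th difference of g_a is therefore (4 + 1)^a, and the
   determinant is the product of the 5^a, a < n. *)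
Require Import Defs.
From mathcomp Require Import all_boot all_order all_algebra.
From mathcomp Require Import zify ring.
Set Implicit Arguments.
Unset Strict Implicit.
Unset Printing Implicit Defensive.
Import GRing.Theory Num.Theory.
Local Open Scope ring_scope.

(** * Determinants of lists of rows *)

(* Only the first [size C] coordinates of the vectors matter. *)
Definition ldet (C : seq (nat -> rat)) : rat :=
  \det (\matrix_(i < size C, j < size C) nth (fun=> 0) C i j).

Lemma ldet_linear (b c : rat) (u v w : nat -> rat) C D :
  (forall a, w a = b * u a + c * v a) ->
  ldet (C ++ w :: D) = b * ldet (C ++ u :: D) + c * ldet (C ++ v :: D).
Proof.
move=> wE; rewrite /ldet !size_cat /=.
have lt : (size C < size C + (size D).+1)%N by rewrite addnS ltnS leq_addr.
have nthE x i : nth (fun=> 0) (C ++ x :: D) i =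
    if i == size C then x else nth (fun=> 0) (C ++ w :: D) i.
  rewrite !nth_cat; case: (ltngtP i (size C)) => // [lti|->];
    last by rewrite subnn.
  by case: (i - _)%N (subn_gt0 (size C) i) => //; rewrite lti.
have row'E x : row' (Ordinal lt) (\matrix_(i, j < size C + (size D).+1)
      nth (fun=> 0) (C ++ x :: D) i j) =
    row' (Ordinal lt) (\matrix_(i, j) nth (fun=> 0) (C ++ w :: D) i j).
  apply/matrixP => i j; rewrite !mxE nthE ifN //.
  by apply: contraNneq (neq_lift (Ordinal lt) i) => e; apply/eqP/val_inj.
apply: determinant_multilinear (row'E u) (row'E v).
by apply/rowP => j; rewrite !mxE !nth_cat ltnn subnn /= wE.
Qed.

Lemma ldetZ (c : rat) (u w : nat -> rat) C D :
  (forall a, w a = c * u a) -> ldet (C ++ w :: D) = c * ldet (C ++ u :: D).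
Proof.
move=> wE; rewrite (@ldet_linear c 0 u u) ?mul0r ?addr0 // => a.
by rewrite wE mul0r addr0.
Qed.

Lemma ldet_alt (u : nat -> rat) C D : ldet (C ++ u :: u :: D) = 0.
Proof.
rewrite /ldet size_cat /=.
have lt1 : (size C < size C + (size D).+2)%N by rewrite -addSnnS leq_addr.
have lt2 : ((size C).+1 < size C + (size D).+2)%N.
  by rewrite -addSnnS -addSnnS leq_addr.
apply: (@determinant_alternate _ _ _ (Ordinal lt1) (Ordinal lt2)).
  by rewrite -val_eqE /= neq_ltn ltnSn.
move=> j; rewrite !mxE !nth_cat /= ltnn subnn ltnNge leqnSn /=.
by rewrite subSn // subnn.
Qed.

Lemma ldet_shear (c : rat) (u v w : nat -> rat) C D :
  (forall a, w a = v a + c * u a) ->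
  ldet (C ++ u :: w :: D) = ldet (C ++ u :: v :: D).
Proof.
move=> wE; rewrite -!(cat_rcons u) (@ldet_linear 1 c v u).
  by rewrite !cat_rcons ldet_alt mulr0 addr0 mul1r.
by move=> a; rewrite wE mul1r.
Qed.

Definition vsub (u v : nat -> rat) (a : nat) : rat := v a - u a.

Lemma ldet_pairmap (u : nat -> rat) C D :
  ldet (D ++ u :: C) = ldet (D ++ u :: pairmap vsub u C).
Proof.
(* The rows after [v] are differenced first, while [v] is still intact; [v] itself is sheared by [u]
   last. *)
elim: C u D => //= v C IHC u D; rewrite -cat_rcons IHC !cat_rcons.
by rewrite (@ldet_shear 1 u (vsub u v)) // => a; rewrite /vsub mul1r subrK.
Qed.

Lemma pairmap_map (I J K : Type) (f : J -> J -> K) (F : I -> J) x s :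
  pairmap f (F x) (map F s) = pairmap (fun y z => f (F y) (F z)) x s.
Proof. by elim: s x => //= y s IHs x; rewrite IHs. Qed.

(** Subtracting from each row its predecessor turns the constant column into [c] followed by zeros,
    and expanding along it leaves the differences, with coordinates shifted by one. Read backwards,
    it restores a row that the differences have lost. *)
Lemma ldet_const_row (I : Type) (c : rat) (F : I -> nat -> rat) x s :
  (forall y, F y 0%N = c) ->
  ldet (map F (x :: s)) =
    c * ldet (pairmap (fun y z a => F z a.+1 - F y a.+1) x s).
Proof.
move=> F0; rewrite /= -[_ :: _]cat0s ldet_pairmap pairmap_map /= /ldet /=.
rewrite !size_pairmap (expand_det_col _ ord0) big_ord_recl big1 => [|i _].
  rewrite addr0 mxE /= F0; congr (_ * _); rewrite /cofactor expr0 mul1r.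
  congr (\det _); apply/matrixP => i j; rewrite !mxE /= /bump /= !add1n /=.
  by rewrite add0n !(nth_pairmap x).
by rewrite mxE lift0 /= (nth_pairmap x) //= /vsub !F0 subrr mul0r.
Qed.

(** * Finite differences and determinants *)

Definition fdiff (F : nat -> rat) (x : nat) : rat := F x.+1 - F x.

Lemma eq_iter_fdiff F G : F =1 G -> forall d, iter d fdiff F =1 iter d fdiff G.
Proof. by move=> FG; elim=> //= d IHd x; rewrite /fdiff !IHd. Qed.

Lemma iter_fdiff_linear (F G H : nat -> rat) (a b c : rat) d x :
  iter d fdiff (fun y => a * F y + b * G y + c * H y) x =
    a * iter d fdiff F x + b * iter d fdiff G x + c * iter d fdiff H x.
Proof. by elim: d x => //= d IHd x; rewrite /fdiff !IHd; ring. Qed.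

Lemma pairmap_iota (K : Type) (f : nat -> nat -> K) x n :
  pairmap f x (iota x.+1 n) = map (fun y => f y y.+1) (iota x n).
Proof. by elim: n x => //= n IHn x; rewrite IHn. Qed.

(** Each pass of row differences splits off the leading constant column and brings the next column
    one difference closer to its own constant. *)
Lemma ldet_fdiff (F : nat -> nat -> rat) (c : nat -> rat) n :
  (forall a x, iter a fdiff (F^~ a) x = c a) ->
  ldet (map F (iota 0 n)) = \prod_(a < n) c a.
Proof.
elim: n F c => [|n IHn] F c Fc; first by rewrite /ldet det_mx00 big_ord0.
rewrite (@ldet_const_row _ (c 0%N)) => [|y]; last exact: (Fc 0%N).
rewrite pairmap_iota (IHn _ (fun a => c a.+1)) ?big_ord_recl // => a x.
by rewrite -(Fc a.+1 x) iterSr.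
Qed.

(** * Parity weights and their iterated trapezoid sums *)

(* With [e] the parity of the row, the weight of -1 in column [x]; the weight
   of +1 is [parity_weight (~~ e) x]. *)
Definition parity_weight (e : bool) (x : nat) : rat :=
  if e (+) odd x then 1 else 2.

Fixpoint trapezoid (e : bool) (a x : nat) : rat :=
  if a is a'.+1 then
    \sum_(0 <= y < x)
       (parity_weight (~~ e) y ^+ 2 * trapezoid (~~ e) a' y +
        parity_weight (~~ e) y.+1 ^+ 2 * trapezoid (~~ e) a' y.+1) / 2
  else 1.

(** A step of two columns adds two trapezoids, with coefficients [u 0 / 2], [u 1], [u 0 / 2] since
    the weights have period 2. These add up to 4 + 1 = 5. The offset [d] is general because the
    middle column has the other parity. *)
Lemma iter_fdiff_trapezoid e d a x :
  iter a fdiff (fun y => trapezoid e a (y.*2 + d)%N) x = 5 ^+ a.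
Proof.
elim: a e d x => [|a IHa] e d x //; rewrite iterSr.
set F := (X in fdiff X).
pose u k := parity_weight (~~ e) (d + k) ^+ 2.
pose h k y := trapezoid (~~ e) a (y.*2 + (d + k))%N.
have FE : fdiff F =1 fun y =>
    (u 0%N / 2) * h 0%N y + u 1%N * h 1%N y + (u 0%N / 2) * h 2%N y.
  move=> y; rewrite /fdiff /F doubleS !addSn /= !big_nat_recr //=.
  have uE k : parity_weight (~~ e) (y.*2 + (d + k))%N ^+ 2 = u k.
    by rewrite /u /parity_weight !oddD odd_double.
  have u2 : u 2%N = u 0%N by rewrite /u /parity_weight !oddD addbF.
  have := (uE 0%N, uE 1%N, uE 2%N); rewrite u2 /h !addnS !addn0 => uE3.
  by rewrite !uE3; field.
rewrite (eq_iter_fdiff FE) iter_fdiff_linear !IHa exprS.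
rewrite /u /parity_weight !oddD; clear.
by case: e; case: (odd d) => /=; field.
Qed.

Lemma ldet_trapezoid e d n :
  ldet [seq (fun a => trapezoid e a (b.*2 + d)%N) | b <- iota 0 n] =
    5 ^+ 'C(n, 2).
Proof.
rewrite (ldet_fdiff (c := fun a => 5 ^+ a)) => [|a x];
  last exact: iter_fdiff_trapezoid.
by rewrite -expr_sum -(big_mkord xpredT id) /= bin2_sum.
Qed.

(** * Transfer of a determinant through one row *)

Section RowTransfer.

Variables (P M : nat -> rat).

(* [l] and [k] are the partial sums of column [x] above and through the row. *)
Definition entry_weight (l k : bool) (x : nat) : rat :=
  if l == k then 1 else if k then P x else M x.

(* [h] is the sum of the entries of the row before column [x]. *)
Fixpoint row_weight (x : nat) (h : bool) (L K : seq bool) : rat :=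
  match L, K with
  | l :: L', k :: K' =>
      if (l == k) || (h == l) then
        entry_weight l k x * row_weight x.+1 (if l == k then h else k) L' K'
      else 0
  | _, _ => h%:R
  end.

Fixpoint positions (x : nat) (K : seq bool) : seq nat :=
  if K is k :: K' then
    if k then x :: positions x.+1 K' else positions x.+1 K'
  else [::].

Lemma sum_tuple_cons (T : finType) n (F : seq T -> rat) :
  \sum_(t : n.+1.-tuple T) F t = \sum_(x : T) \sum_(t : n.-tuple T) F (x :: t).
Proof.
rewrite pair_bigA (reindex (fun p : T * n.-tuple T => cons_tuple p.1 p.2)) //.
apply: onW_bij; exists (fun t => (thead t, behead_tuple t)) => [[x t]|t] /=.
  by congr pair; apply: val_inj.
by rewrite [RHS]tuple_eta; apply: val_inj.
Qed.

Hypothesis PM : forall x, P x * M x = 2.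

Variables (f G : nat -> nat -> rat).

Hypothesis Gstep : forall x a,
  G x.+1 a - G x a = (M x * f x a + M x.+1 * f x.+1 a) / 2.

(* When the scan starts inside an interval ([h = true]), the pending trapezoid
   sum includes the full weight of [x], hence the start [G x - M x / 2 * f x].
   The trapezoid sums also contain terms with equal [l]'s, whose determinants
   vanish. *)
Lemma row_transfer_scan (K : seq bool) C x :
  \sum_(L : (size K).-tuple bool)
     row_weight x true L K * ldet (C ++ map f (positions x L)) =
    \prod_(k <- positions x K) P k *
    ldet (C ++ pairmap vsub (fun a => G x a - M x / 2 * f x a)
                           (map G (positions x K)))
  /\
  \sum_(L : (size K).-tuple bool)
     row_weight x false L K * ldet (C ++ map f (positions x L)) =
    if positions x K is k :: ks then
      \prod_(j <- k :: ks) P j * ldet (C ++ pairmap vsub (G k) (map G ks))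
    else 0.
Proof.
have sum0 (F : seq bool -> rat) : \sum_(L : 0.-tuple bool) F L = F [::].
  rewrite (big_pred1 [tuple]) // => t.
  exact/esym/eqP/tuple0.
elim: K C x => [|k K IHK] C x.
  pose S h L := row_weight x h L [::] * ldet (C ++ map f (positions x L)).
  by rewrite (sum0 (S true)) (sum0 (S false)) /S /= big_nil mul0r.
have [IH1 IH0] := IHK C x.+1.
have [IH1f IH0f] := IHK (rcons C (f x)) x.+1.
(* Column [x] is split off: with [l] true, [f x] joins the finished rows [C]; with [l] false, [C] is
   unchanged. *)
have scan h : \sum_(L : (size (k :: K)).-tuple bool)
    row_weight x h L (k :: K) * ldet (C ++ map f (positions x L)) =
  (if k || h then entry_weight true k x *
     \sum_(L : (size K).-tuple bool) row_weight x.+1 (k && h) L K *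
       ldet (rcons C (f x) ++ map f (positions x.+1 L)) else 0) +
  (if ~~ k || ~~ h then entry_weight false k x *
     \sum_(L : (size K).-tuple bool) row_weight x.+1 (k || h) L K *
       ldet (C ++ map f (positions x.+1 L)) else 0).
  rewrite (sum_tuple_cons _ (fun L =>
    row_weight x h L _ * ldet (C ++ map f (positions x L)))).
  rewrite big_bool /=; congr (_ + _).
    case: k; case: h; rewrite /= ?mulr_sumr;
      try (by rewrite big1 // => L _; rewrite mul0r);
      by apply: eq_bigr => L _; rewrite cat_rcons mulrA.
  case: k; case: h; rewrite /= ?mulr_sumr;
    try (by rewrite big1 // => L _; rewrite mul0r);
    by apply: eq_bigr => L _; rewrite mulrA.
have Gx a : G x.+1 a = G x a + (M x * f x a + M x.+1 * f x.+1 a) / 2.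
  by rewrite -Gstep addrC subrK.
(* Where [l] and [k] are both true the entry is 0, of weight 1; written as [P x * (M x / 2)], it is
   the half weight at an end of a trapezoid sum. *)
have PM2 : P x * (M x / 2) = 1 by rewrite mulrA PM divff.
pose Gp a := G x.+1 a - M x.+1 / 2 * f x.+1 a.
rewrite !{}scan; case: k => /=;
  rewrite ?{}IH1 ?{}IH0 ?{}IH1f ?{}IH0f /entry_weight /= -?/Gp;
  rewrite ?mul1r ?add0r ?addr0 ?cat_rcons;
  case: (positions x.+1 K) => [|k ks];
  rewrite ?big_cons ?big_nil /=; split=> //.
- rewrite [in RHS](@ldetZ (M x / 2) (f x)); last first.
    by move=> a; rewrite /vsub; ring.
  by rewrite mulr1 mulrA PM2.
- by rewrite add0r !mulr1 mul1r.
- rewrite [in RHS](@ldetZ (M x / 2) (f x)); last first.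
    by move=> a; rewrite /vsub; ring.
  (* The next interval also starts with a half share of [f x], but this row is already present and
     the determinant drops it. *)
  rewrite [in RHS](@ldet_shear (M x / 2) (f x) (vsub Gp (G k))); last first.
    by move=> a; rewrite /vsub /Gp Gx; field.
  by rewrite -[LHS]mul1r -[X in X * _ = _]PM2; ring.
- rewrite [in RHS](@ldet_linear 1 (M x / 2) (vsub Gp (G k)) (f x)); last first.
    by move=> a; rewrite /vsub /Gp Gx; field.
  by rewrite cat_rcons -[X in X + _ = _]mul1r -[X in X * _ + _ = _]PM2; ring.
- by rewrite mulr0 add0r.
- rewrite [in RHS](@ldet_linear 1 (M x) (vsub Gp (G k)) (f x)); last first.
    by move=> a; rewrite /vsub /Gp Gx; field.
  by rewrite cat_rcons; ring.
Qed.

Lemma row_transfer (K : seq bool) :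
  \sum_(L : (size K).-tuple bool)
     row_weight 0 false L K * ldet (map f (positions 0 L)) =
    if positions 0 K is k :: ks then
      \prod_(j <- k :: ks) P j * ldet (pairmap vsub (G k) (map G ks))
    else 0.
Proof. exact: (row_transfer_scan K [::] 0).2. Qed.

End RowTransfer.

(** * Weighted path sums as determinants *)

Lemma size_positions x K : size (positions x K) = count id K.
Proof. by elim: K x => //= -[] K IHK x /=; rewrite IHK. Qed.

(** A nonzero weight forces the running sum to end at 1, so the remaining entries add up to [1 - h].
    In a full row, [K] has one point more than [L]. *)
Lemma row_weight_count P M x h L K :
  size L = size K -> row_weight P M x h L K != 0 ->
  (count id L).+1 = (count id K + h)%N.
Proof.
elim: K L x h => [|k K IHK] [|l L] x h //=; first by case: h; rewrite ?eqxx.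
case=> szL; case: ifP => [lkh|]; last by rewrite eqxx.
rewrite mulf_eq0 negb_or => /andP[_ /(IHK _ _ _ szL)].
by case: l h k lkh => [] [] [] //= _; rewrite ?addn0 ?addn1 ?add1n => ->.
Qed.

Lemma ldet_scale (c : nat -> rat) (F : nat -> nat -> rat) C s :
  ldet (C ++ [seq (fun a => c k * F k a) | k <- s]) =
    \prod_(k <- s) c k * ldet (C ++ map F s).
Proof.
elim: s C => [|k s IHs] C; first by rewrite big_nil mul1r.
by rewrite big_cons /= (@ldetZ (c k) (F k)) // -!cat_rcons IHs mulrA.
Qed.

(** A transfer recursion for the total weight of the paths of [r] rows from the empty set to [K];
    the last row has index [r'], counted from 0. *)
Fixpoint path_sum (m r : nat) : m.-tuple bool -> rat :=
  if r is r'.+1 then fun K =>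
    \sum_(L : m.-tuple bool)
      row_weight (parity_weight (~~ odd r')) (parity_weight (odd r')) 0 false
                 L K * path_sum r' L
  else fun K => (K == nseq_tuple m false)%:R.

(** In the induction, a point [l] gets one factor [parity_weight (odd r) l] from the row above,
    where it weighs a possible 1, and the same factor from the new row, where it weighs a possible
    -1. Hence the squared weight in [trapezoid]. *)
Lemma path_sum_det m r (K : m.-tuple bool) : count id K = r ->
  path_sum r K = \prod_(k <- positions 0 K) parity_weight (odd r) k *
             ldet [seq trapezoid (odd r) ^~ k | k <- positions 0 K].
Proof.
elim: r K => [|r IHr] K cK.
  rewrite /=; have := size_positions 0 K; rewrite cK.
  case: (positions 0 K) => //= _.
  rewrite big_nil mul1r /ldet det_mx00.
  suff -> : K = nseq_tuple m false by rewrite eqxx.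
  apply: val_inj => /=; rewrite -[m in nseq m](size_tuple K).
  move/eqP: cK; rewrite -leqn0 leqNgt -has_count -all_predC.
  by rewrite (eq_all (a2 := pred1 false)) => [/all_pred1P <-|[]].
have PM x : parity_weight (~~ odd r) x * parity_weight (odd r) x = 2.
  by rewrite /parity_weight; case: (odd r); case: (odd x).
pose f x a := parity_weight (odd r) x * trapezoid (odd r) a x.
pose G x a := trapezoid (~~ odd r) a.+1 x.
have Gstep x a : G x.+1 a - G x a =
    (parity_weight (odd r) x * f x a +
     parity_weight (odd r) x.+1 * f x.+1 a) / 2.
  rewrite /G /= big_nat_recr //= negbK [X in X - _]addrC addrK /f.
  by rewrite !mulrA -!expr2.
pose W (L : m.-tuple bool) :=
  row_weight (parity_weight (~~ odd r)) (parity_weight (odd r)) 0 false L K.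
rewrite /= (eq_bigr (fun L => W L * ldet (map f (positions 0 L)))).
  have := row_transfer PM Gstep K; rewrite size_tuple => ->.
  have := size_positions 0 K; rewrite cK; case: (positions 0 K) => // k ks _.
  by rewrite (@ldet_const_row _ 1) // mul1r pairmap_map.
(* The induction hypothesis only covers sets of [r] points; all others have [W L = 0]. *)
move=> L _; rewrite -/(W L); have [->|nz] := eqVneq (W L) 0.
  by rewrite !mul0r.
congr (_ * _); rewrite IHr.
  by rewrite -[RHS]/(ldet ([::] ++ _)) ldet_scale.
have := row_weight_count (etrans (size_tuple L) (esym (size_tuple K))) nz.
by rewrite cK addn0 => -[].
Qed.

(** * Evaluation at the columns of one parity *)

Lemma positions_map_iota p x n :
  positions x (map p (iota x n)) = filter p (iota x n).
Proof. by elim: n x => //= n IHn x; rewrite IHn; case: (p x). Qed.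

Lemma filter_parity (b : bool) x n :
  filter (fun j => odd j (+) b) (iota x.*2 n.*2) =
  [seq (i.*2 + ~~ b)%N | i <- iota x n].
Proof.
elim: n x => //= n IHn x; rewrite odd_double /= -doubleS IHn.
by clear IHn; case: b => /=; rewrite ?addn0 ?addn1.
Qed.

Lemma path_sum_parity (b : bool) n (K : n.*2.-tuple bool) :
  (forall j, tnth K j = odd j (+) b) ->
  path_sum n K = (if odd n (+) b then 2 ^+ n else 1) * 5 ^+ 'C(n, 2).
Proof.
move=> KE; have {KE}K_E :
    K = map (fun j => odd j (+) b) (iota 0 n.*2) :> seq bool.
  apply: (@eq_from_nth _ false) => [|i];
    rewrite size_tuple ?size_map ?size_iota //.
  move=> lti; rewrite (nth_map 0%N) ?size_iota // nth_iota // add0n.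
  by rewrite -(KE (Ordinal lti)) (tnth_nth false).
have posK : positions 0 K = [seq (i.*2 + ~~ b)%N | i <- iota 0 n].
  by rewrite K_E positions_map_iota (filter_parity b 0).
rewrite path_sum_det; last first.
  by rewrite -(size_positions 0) posK size_map size_iota.
rewrite posK -map_comp ldet_trapezoid big_map; congr (_ * _).
rewrite (eq_bigr (fun=> if odd n (+) b then 2 else 1)) => [|i _].
  rewrite big_const_seq count_predT size_iota iter_mulr_1.
  by case: ifP => _; rewrite ?expr1n.
by rewrite /parity_weight oddD odd_double; case: (odd n); case: b {K_E posK}.
Qed.

(** * Path sums unrolled into sums over sequences of sets *)

Lemma sum_tuple_rcons (T : finType) n (F : n.+1.-tuple T -> rat) :
  \sum_t F t = \sum_(x : T) \sum_(t : n.-tuple T) F [tuple of rcons t x].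
Proof.
rewrite pair_bigA.
rewrite (reindex (fun p : T * n.-tuple T => [tuple of rcons p.2 p.1])) //.
apply/onW_bij/inj_card_bij; last by rewrite card_prod !card_tuple expnS.
by move=> [x s] [y t] /= /(congr1 val) /rcons_inj[/val_inj -> ->].
Qed.

(** Prepending [O] shifts the index: [nth O (O :: t) i] is the set before row [i] and [nth O t i]
    the set after it. *)
Lemma path_sum_tuple m r (K : m.-tuple bool) (O := nseq_tuple m false) :
  path_sum r K =
  \sum_(t : r.-tuple (m.-tuple bool) | nth O (O :: t) r == K)
    \prod_(i < r)
      row_weight (parity_weight (~~ odd i)) (parity_weight (odd i)) 0 false
                 (nth O (O :: t) i) (nth O t i).
Proof.
elim: r K => [|r IHr] K /=.
  rewrite (eq_bigl (fun=> O == K)) // big_mkcond /= (big_pred1 [tuple]) => [|t].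
    by rewrite big_ord0 eq_sym; case: eqP.
  exact/esym/eqP/tuple0.
rewrite [RHS]big_mkcond [RHS]sum_tuple_rcons [RHS](bigD1 K) //=.
rewrite [X in _ + X]big1 => [|L LK].
  rewrite addr0; under [RHS]eq_bigr => t _.
    rewrite nth_rcons size_tuple ltnn eqxx eqxx big_ord_recr /= -rcons_cons.
    rewrite !nth_rcons /= !size_tuple ltnSn ltnn eqxx.
    under eq_bigr => i _.
      rewrite -rcons_cons nth_rcons /= size_tuple ltnW ?ltnS //.
      rewrite nth_rcons size_tuple ltn_ord.
      over.
    over.
  (* The paths are grouped by their last set before the final row. *)
  rewrite (partition_big (fun t : r.-tuple _ => nth O (O :: t) r) xpredT) //=.
  apply: eq_bigr => L _; rewrite IHr mulr_sumr; apply: eq_bigr => t /eqP ->.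
  by rewrite mulrC.
by apply: big1 => t _; rewrite nth_rcons size_tuple ltnn eqxx (negPf LK).
Qed.

(** * Alternating sequences and their partial sums *)

(* The condition on the nonzero entries of a sequence when the sum of what
   precedes it is [h]. *)
Definition alternates (h : bool) (s : seq int) : bool :=
  path (fun x y => y == - x) (if h then 1 else -1) (nonzeros s).

Lemma alternates_cons h x s : alternates h (x :: s) =
  if x == 0 then alternates h s
  else (x == if h then -1 else 1) && alternates (~~ h) s.
Proof.
rewrite /alternates /nonzeros /=; case: eqP => //= _.
by case: h; rewrite ?opprK; case: eqP => // ->.
Qed.

Lemma alternates_take h s i : alternates h s -> alternates h (take i s).
Proof.
elim: s h i => [|x s IHs] h [|i] //; rewrite /= !alternates_cons.
by case: ifP => _; [apply: IHs | case/andP=> -> /IHs ->].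
Qed.

Lemma alternates_sum h s : alternates h s ->
  exists b : bool, (h : nat)%:Z + \sum_(x <- s) x = (b : nat)%:Z.
Proof.
elim: s h => [|x s IHs] h; first by exists h; rewrite big_nil addr0.
rewrite alternates_cons big_cons; case: eqP => [-> /IHs[b bE]|_].
  by exists b; rewrite add0r.
by case/andP=> /eqP-> /IHs[b bE]; exists b; move: bE; case: h; rewrite addrA.
Qed.

Lemma alternating_head s :
  alternating s && (head 1 (nonzeros s) == 1) = alternates false s.
Proof.
rewrite /alternating /alternates; case: nonzeros => //= y r.
by rewrite opprK andbC.
Qed.

(** For rows the sum 1 replaces the condition on the first nonzero entry: after an initial -1 the
    rest would sum to 0 or 1, so the total could not be 1. *)
Lemma alternating_sum s : all (mem [:: 0; 1; -1]) s ->
  alternating s && (\sum_(x <- s) x == 1) =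
  alternates false s && (\sum_(x <- s) x == 1).
Proof.
move=> s_ent; rewrite -alternating_head -andbA.
case alt: (alternating s) => //=; case: eqP => [s1|]; last by rewrite andbF.
rewrite andbT; apply/esym/eqP; move: alt s1; elim: s s_ent => [|x s IHs] //=.
rewrite /alternating /nonzeros /= big_cons => /andP[x_ent s_ent].
case: eqP => [-> |x0] /=; first by rewrite add0r; apply: IHs.
move: x_ent; rewrite !inE; case: eqP => //= _; case: eqP => //= _ /eqP ->.
move=> alt s1; have /alternates_sum[b] : alternates false s by [].
by rewrite add0r => bE; move: s1; rewrite bE; case: b {bE}.
Qed.

Definition bit_diff (l k : bool) : int := (k : nat)%:Z - (l : nat)%:Z.

Definition entry_of_bits (l k : bool) : entry :=
  insubd (SeqSub (mem_head 0 [:: 1; -1])) (bit_diff l k).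

Lemma val_entry_of_bits l k : val (entry_of_bits l k) = bit_diff l k.
Proof. by rewrite insubdK //; case: l; case: k. Qed.

(** The test at each column of [row_weight] is the alternation condition, and its final value [h%:R]
    enforces the row sum 1. *)
Lemma row_weight_alternates P M x h (L K : seq bool) : size L = size K ->
  let s := [seq bit_diff p.1 p.2 | p <- zip L K] in
  row_weight P M x h L K =
    if alternates h s && ((h : nat)%:Z + \sum_(y <- s) y == 1) then
      \prod_(j < size K)
         entry_weight P M (nth false L j) (nth false K j) (x + j)
    else 0.
Proof.
elim: K L x h => [|k K IHK] [|l L] x h //=.
  by rewrite big_nil big_ord0; case: h.
move=> [szL]; rewrite alternates_cons big_cons big_ord_recl addn0 /= IHK //.
rewrite [in RHS](eq_bigr (fun j : 'I_(size K) =>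
    entry_weight P M (nth false L j) (nth false K j) (x.+1 + j))); last first.
  by move=> j _; rewrite addSnnS.
by case: l; case: k; case: h; rewrite //= ?subrr ?addrA ?addr0 ?add0r ?mul1r;
   case: ifP => // _; rewrite mulr0.
Qed.

(** The partial sums are bits, so two successive nonzero differences have opposite signs. This makes
    the columns of [state_mx] alternate for every sequence of sets. *)
Lemma alternates_pairmap h u :
  alternates h (pairmap bit_diff h u).
Proof.
elim: u h => //= k u IHu h; rewrite alternates_cons.
by case: h k (IHu k) => [] [].
Qed.

(** * Matrices as sequences of column sets *)

Section States.

Variable n : nat.

Local Notation T := (n.*2.-tuple bool).
Local Notation O := (nseq_tuple n.*2 false).

Definition state (t : seq T) (i j : nat) : bool := nth false (nth O t i) j.

Definition state_mx (t : n.-tuple T) : 'M[entry]_(n, n.*2) :=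
  \matrix_(i, j) entry_of_bits (state (O :: t) i j) (state t i j).

Definition mx_states (A : 'M[entry]_(n, n.*2)) : n.-tuple T :=
  [tuple [tuple \sum_(l < n | (l <= i)%N) val (A l j) == 1 | j < n.*2] | i < n].

Lemma stateO j t : state (O :: t) 0 j = false.
Proof. by rewrite /state /= nth_nseq if_same. Qed.

Lemma state_mx_sum (t : n.-tuple T) i (j : 'I_n.*2) : (i <= n)%N ->
  \sum_(l < n | (l < i)%N) val (state_mx t l j) = (state (O :: t) i j : nat)%:Z.
Proof.
move=> le_in; pose F k := (state (O :: t) k j : nat)%:Z.
under eq_bigr => l _.
  rewrite mxE val_entry_of_bits -[bit_diff _ _]/(F l.+1 - F l); over.
rewrite -(big_ord_widen _ (fun l => F l.+1 - F l)) //.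
rewrite -(big_mkord xpredT (fun l => F l.+1 - F l)).
by rewrite telescope_sumr // /F stateO subr0.
Qed.

Lemma state_mxK : cancel state_mx mx_states.
Proof.
move=> t; apply: eq_from_tnth => i; apply: eq_from_tnth => j.
rewrite !tnth_mktuple.
under eq_bigl => l do rewrite -ltnS.
rewrite state_mx_sum // [state _ _ _]/(state t i j) /state -!tnth_nth.
by case: (tnth (tnth t i) j).
Qed.

Lemma col_seq_sum (A : 'M[entry]_(n, n.*2)) j i : (i <= n)%N ->
  \sum_(l < n | (l < i)%N) val (A l j) = \sum_(x <- take i (col_seq A j)) x.
Proof.
move=> le_in; pose F k := if insub k is Some l then val (A l j) else 0.
have FE (l : 'I_n) : F l = val (A l j) by rewrite /F valK.
have -> : col_seq A j = map F (iota 0 n).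
  by rewrite -val_enum_ord -map_comp; apply/esym/eq_map => l; apply: FE.
rewrite -map_take take_iota (minn_idPl le_in) big_map.
rewrite [LHS](eq_bigr (fun l : 'I_n => F l)) => [|l _]; last by rewrite FE.
by rewrite -(big_ord_widen _ F) // -(big_mkord xpredT F) /index_iota subn0.
Qed.

(** Alternation keeps the partial column sums in {0, 1}, so the test [== 1] in [mx_states] loses
    nothing and the entries return as differences. *)
Lemma mx_statesK (A : 'M[entry]_(n, n.*2)) :
  (forall j, alternates false (col_seq A j)) -> state_mx (mx_states A) = A.
Proof.
move=> A_col; apply/matrixP => i j; apply: val_inj.
pose S k := \sum_(l < n | (l < k)%N) val (A l j).
have S_state k : (k <= n)%N -> S k = (state (O :: mx_states A) k j : nat)%:Z.
  case: k => [|k] lt_kn; first by rewrite stateO /S big_pred0.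
  rewrite -[state _ _ _]/(state (mx_states A) (Ordinal lt_kn) j) /state.
  rewrite -!tnth_nth !tnth_mktuple.
  have [b] := alternates_sum (alternates_take k.+1 (A_col j)).
  rewrite -col_seq_sum // add0r -/(S k.+1) => Sb.
  by rewrite -[X in X == 1]/(S k.+1) Sb; case: (b).
rewrite mxE val_entry_of_bits /bit_diff -(S_state i) ?(ltnW (ltn_ord i)) //.
rewrite -[state _ _ _]/(state (O :: mx_states A) i.+1 j) -S_state //.
rewrite /S (bigD1 i) //= (eq_bigl (fun l : 'I_n => (l < i)%N)) ?addrK // => l.
by rewrite ltnS ltn_neqAle andbC.
Qed.

Lemma halved_asm_alternates (A : 'M[entry]_(n, n.*2)) :
  halved_asm A = [forall j, alternates false (col_seq A j)] &&
    [forall i, alternates false (row_seq A i) &&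
               (\sum_(x <- row_seq A i) x == 1)].
Proof.
have rowE i : (alternating (row_seq A i)) && (\sum_j val (A i j) == 1) =
    alternates false (row_seq A i) && (\sum_(x <- row_seq A i) x == 1).
  rewrite -alternating_sum; last first.
    by apply/allP => _ /mapP[j _ ->]; apply: ssvalP.
  by rewrite [in RHS]big_map big_enum.
apply/and4P/andP => [[/forallP r1 /forallP c1 /forallP r2 /forallP c2]|].
  split; apply/forallP => i; rewrite -?rowE -?alternating_head.
    by rewrite c1 c2.
  by rewrite r1 r2.
move=> [/forallP c /forallP r]; split; apply/forallP => i.
- by have := r i; rewrite -rowE => /andP[].
- by have := c i; rewrite -alternating_head => /andP[].
- by have := r i; rewrite -rowE => /andP[].
- by have := c i; rewrite -alternating_head => /andP[].
Qed.

Lemma col_seq_state_mx (t : n.-tuple T) j :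
  col_seq (state_mx t) j =
  pairmap bit_diff false [seq nth false (x : T) j | x <- t].
Proof.
have szc : size (col_seq (state_mx t) j) = n by rewrite size_map size_enum_ord.
apply: (@eq_from_nth _ 0).
  by rewrite szc size_pairmap size_map size_tuple.
rewrite szc => i lt_in; rewrite (nth_map (Ordinal lt_in)) ?size_enum_ord //.
rewrite (nth_pairmap false) ?size_map ?size_tuple // mxE val_entry_of_bits.
rewrite nth_enum_ord // (nth_map O) ?size_tuple //; congr bit_diff.
case: i {szc} lt_in => [|i] lt_in.
  by rewrite stateO.
by rewrite /= (nth_map O) // size_tuple ltnW.
Qed.

Lemma row_seq_state_mx (t : n.-tuple T) (i : 'I_n) :
  row_seq (state_mx t) i =
  [seq bit_diff p.1 p.2 | p <- zip (nth O (O :: t) i) (nth O t i)].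
Proof.
have szr : size (row_seq (state_mx t) i) = n.*2.
  by rewrite size_map size_enum_ord.
apply: (@eq_from_nth _ 0).
  by rewrite szr size_map size_zip !size_tuple minnn.
rewrite szr => j lt_j; rewrite (nth_map (Ordinal lt_j)) ?size_enum_ord //.
rewrite (nth_map (false, false)) ?size_zip ?size_tuple ?minnn //.
by rewrite nth_zip ?size_tuple //= mxE val_entry_of_bits nth_enum_ord.
Qed.

Lemma weight_prod (t : n.-tuple T) :
  (weight (state_mx t))%:R = \prod_(i < n) \prod_(j < n.*2)
    entry_weight (parity_weight (~~ odd i)) (parity_weight (odd i))
                 (state (O :: t) i j) (state t i j) j.
Proof.
rewrite /weight /num_minus_even /num_plus_odd natrX -!sum1dep_card.
rewrite [X in (X + _)%N]big_mkcond [X in (_ + X)%N]big_mkcond -big_split /=.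
rewrite expr_sum pair_bigA; apply: eq_bigr => -[i j] _ /=.
rewrite mxE val_entry_of_bits oddD /entry_weight /parity_weight.
by case: (odd i); case: (odd j); case: (state (O :: t) i j);
   case: (state t i j).
Qed.

Lemma height_state_mx (t : n.-tuple T) j : (j <= n.*2)%N ->
  height (state_mx t) n j =
  (n + j)%N%:Z - 2 * \sum_(0 <= r < j) (state (O :: t) n r : nat)%:Z.
Proof.
move=> le_j; rewrite /height exchange_big /= big_mkord; congr (_ - 2 * _).
rewrite (big_ord_widen _ (fun r => (state (O :: t) n r : nat)%:Z) le_j).
by apply: eq_bigr => r _; apply: state_mx_sum.
Qed.

(** Along the bottom row the height changes by 1 minus twice the bit of the last set. A dip to
    [n - 1] between two values [n] therefore means bits 1, 0, and a rise to [n + 1] means bits 0,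
    1. *)
Lemma bdry_state_mx (b : bool) (t : n.-tuple T) :
  [forall i : 'I_n.+1, height (state_mx t) n i.*2 == n%:Z] &&
  [forall i, bottom (state_mx t) i == n%:Z + (if b then -1 else 1)] =
  (nth O (O :: t) n == [tuple odd j (+) b | j < n.*2]).
Proof.
set K := nth O (O :: t) n.
pose S j := \sum_(0 <= r < j) (state (O :: t) n r : nat)%:Z.
have SS j : S j.+1 = S j + (nth false K j : nat)%:Z by rewrite /S big_nat_recr.
apply/andP/eqP => [[/forallP h0 /forallP h1]|KE].
  have KE i : (i < n)%N ->
      nth false K i.*2 = b /\ nth false K i.*2.+1 = ~~ b.
    move=> lt_i; have := h0 (Ordinal (leqW lt_i : (i < n.+1)%N)).
    have := h0 (Ordinal (lt_i : (i.+1 < n.+1)%N)).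
    have := h1 (Ordinal lt_i).
    rewrite /bottom !height_state_mx /= -?/(S _); try lia.
    rewrite doubleS !SS; case: (b); case: (nth false K _.+1);
      case: (nth false K _) => //=; lia.
  apply: eq_from_tnth => -[j lt_j]; rewrite tnth_mktuple (tnth_nth false) /=.
  have [Ke Ko] : nth false K (j./2).*2 = b /\ nth false K (j./2).*2.+1 = ~~ b.
    by apply: KE; rewrite ltn_half_double.
  by rewrite -{1}(odd_double_half j); case: (odd j); rewrite ?Ke ?Ko.
have SE i : (i <= n)%N -> S i.*2 = i%:Z.
  elim: i => [|i IHi] lt_i; first by rewrite /S big_nil.
  have lt2 : (i.*2.+1 < n.*2)%N by lia.
  rewrite doubleS !SS (IHi (ltnW lt_i)) KE.
  rewrite -[i.*2.+1]/(val (Ordinal lt2)) -[i.*2]/(val (Ordinal (ltnW lt2))).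
  by rewrite -!tnth_nth !tnth_mktuple /= odd_double; case: b {KE} => /=; lia.
split; apply/forallP => i.
  by rewrite height_state_mx -?/(S _) ?SE; have := ltn_ord i; lia.
have lt2 : (i.*2 < n.*2)%N by rewrite ltn_double.
rewrite /bottom height_state_mx // -/(S _) SS (SE _ (ltnW (ltn_ord i))) KE.
rewrite -[i.*2]/(val (Ordinal lt2)) -!tnth_nth !tnth_mktuple /= odd_double.
by case: b {KE} => /=; lia.
Qed.

Lemma sum_weight_halved (b : bool) :
  (\sum_(A in halved_bdry n |
         [forall i, bottom A i == n%:Z + (if b then -1 else 1)]) weight A)%:R =
  path_sum n [tuple odd j (+) b | j < n.*2].
Proof.
rewrite path_sum_tuple natr_sum.
(* Only alternating columns are needed to recover [A] from its sets. *)
rewrite (reindex_onto state_mx mx_states) => [|A]; last first.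
  rewrite inE halved_asm_alternates -!andbA => /andP[/forallP A_col _].
  exact: mx_statesK.
rewrite big_mkcond [RHS]big_mkcond; apply: eq_bigr => t _.
rewrite state_mxK eqxx andbT inE -andbA bdry_state_mx andbC.
case: eqP => //= _; rewrite halved_asm_alternates.
have -> : [forall j, alternates false (col_seq (state_mx t) j)].
  by apply/forallP => j; rewrite col_seq_state_mx alternates_pairmap.
under [RHS]eq_bigr => i _.
  rewrite row_weight_alternates ?size_tuple // add0r -row_seq_state_mx; over.
case: forallP => [rows | rows] /=.
  rewrite weight_prod; apply: eq_bigr => i _; rewrite rows.
  by apply: eq_bigr => j _; rewrite add0n.
(* A path whose matrix violates a row condition has a row of weight 0. *)
have /forallPn[i /negPf rowi] := introN forallP rows.
by rewrite (bigD1 i) //= rowi mul0r.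
Qed.
End States.

Local Close Scope ring_scope.

Theorem theorem3 (n : nat) (n_ge1 : 1 <= n) :
  \sum_(A in halved_plus n) weight A =
    (if ~~ odd n then 5 ^ 'C(n, 2) else 2 ^ n * 5 ^ 'C(n, 2))
  /\
  \sum_(A in halved_minus n) weight A =
    (if ~~ odd n then 2 ^ n * 5 ^ 'C(n, 2) else 5 ^ 'C(n, 2)).
Proof.
have main (b : bool) :
    \sum_(A in halved_bdry n |
           [forall i, bottom A i == n%:Z + (if b then -1 else 1)]%R) weight A =
    (if odd n (+) b then 2 ^ n else 1) * 5 ^ 'C(n, 2).
  (* The identity is moved to [rat], where the halves of the trapezoid sums live. *)
  apply/eqP; rewrite -(eqr_nat rat) sum_weight_halved.
  rewrite (path_sum_parity (b := b)).
    by rewrite natrM natrX; case: ifP; rewrite ?natrX.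
  by move=> j; rewrite tnth_mktuple.
split.
  rewrite (eq_bigl _ _ (fun A => in_set _ _)) (main false) addbF.
  by case: odd; rewrite ?mul1n.
rewrite (eq_bigl _ _ (fun A => in_set _ _)) (main true) addbT.
by case: odd; rewrite ?mul1n.
Qed.
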